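(* Let $\Omega\subseteq\mathbb{R}^d$ be a domain and let $H$ be a reproducing kernel Hilbert space of functions $f:\Omega\to\mathbb{R}$. Let $H_1$ be a closed subspace of $H$ and let $H_2=H_1^\perp$. Let $1\le p,q\le\infty$ and let $X=\{x_1,\ldots,x_N\}\subseteq\Omega$ be a set of $N$ points. Assume that there are a constant $C>0$ and two functions $F_1,F_2:\mathbb{N}\to[0,\infty)$ with $F_1(N),F_2(N)>0$ such that $$\|g\|_{L_q(\Omega)}\le C\left[F_1(N)\|g\|_H+F_2(N)\|g\|_{\ell_p(X)}\right],\qquad g\in H_1.$$ Let $\lambda>0$ be given by $\sqrt{\lambda}:=F_1(N)/F_2(N)$. Then, for any $f=f_1+f_2\in H$ with $f_i\in H_i$, $i=1,2$, $$\|f-Q_{X,\lambda}f\|_{L_q(\Omega)}\le\|f_2\|_{L_q(\Omega)}+2C(1+c_p)\left[F_1(N)\|f\|_H+F_2(N)\|f_2\|_{\ell_2(X)}\right].$$ In particular, for $p=q=\infty$ there is a constant $\widetilde{C}>0$, independent of $f$, such that $$\|f-Q_{X,\lambda}f\|_{L_\infty(\Omega)}\le\widetilde{C}\left[F_1(N)\|f\|_H+\sqrt{N}\,F_2(N)\|f_2\|_{L_\infty(\Omega)}\right].$$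
   Context: The regularized approximation of $f\in H$ from $H_1$ is $$Q_{X,\lambda}f:=\operatorname*{arg\,min}_{s\in H_1}\left(\sum_{j=1}^N|f(x_j)-s(x_j)|^2+\lambda\|s\|_H^2\right).$$ For a function $g$ on $\Omega$, $\|g\|_{\ell_p(X)}:=\|(g(x_1),\ldots,g(x_N))\|_p$, the usual $\ell_p$-norm on $\mathbb{R}^N$. The constant $c_p$ is the equivalence constant in $\|y\|_p\le c_p\|y\|_2$, $y\in\mathbb{R}^N$, namely $c_p=N^{1/p-1/2}$ if $1\le p\le 2$ and $c_p=1$ if $p\ge 2$. The norm $\|\cdot\|_{L_\infty(\Omega)}$ is understood as the supremum norm over $\Omega$, so that it bounds point values. *)

(* Defs.v *)
From HB Require Import structures.
From mathcomp Require Import all_boot all_order all_algebra.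
From mathcomp Require Import all_classical all_reals all_analysis.

Set Implicit Arguments.
Unset Strict Implicit.
Unset Printing Implicit Defensive.

Import Order.TTheory GRing.Theory Num.Theory.
Import numFieldNormedType.Exports.

Local Open Scope classical_set_scope.
Local Open Scope ring_scope.

(* Lebesgue measure on R^(d+1): the Caratheodory measure of the outer measure
   given by countable covers by half-open boxes.  The dimension is positive,
   so that the empty set is a box. *)
Section lebesgue_rV.
Context (R : realType) (d : nat).
Local Notation V := 'rV[R]_d.+1.

Definition box (ab : V * V) : set V :=
  [set x | forall i, ab.1 ord0 i < x ord0 i <= ab.2 ord0 i].

Definition box_volume (ab : V * V) : \bar R :=
  (\prod_(i < d.+1) (ab.2 ord0 i - ab.1 ord0 i))%:E.

Definition box_cover (A : set V) : set (nat -> V * V) :=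
  [set ab : nat -> V * V | (forall k i, (ab k).1 ord0 i <= (ab k).2 ord0 i) /\
            A `<=` \bigcup_k box (ab k)].

Definition lebesgue_outer (A : set V) : \bar R :=
  ereal_inf [set (\sum_(k <oo) box_volume (ab k))%E | ab in box_cover A].

Local Open Scope ereal_scope.

Let box_volume_ge0 A (ab : nat -> V * V) k : box_cover A ab -> 0 <= box_volume (ab k).
Proof. by case=> le_ab _; rewrite lee_fin prodr_ge0// => i _; rewrite subr_ge0. Qed.

Let lebesgue_outer_ge0 A : 0 <= lebesgue_outer A.
Proof.
apply: le_ereal_inf_tmp => _ [ab cab <-]; apply: nneseries_ge0 => k _ _.
exact: box_volume_ge0 cab.
Qed.

Let lebesgue_outer0 : lebesgue_outer set0 = 0.
Proof.
apply/eqP; rewrite eq_le lebesgue_outer_ge0 andbT.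
apply: ereal_inf_lbound; exists (fun=> (0%R, 0%R)).
  by split=> // k i /=.
rewrite eseries0// => k _ _.
by rewrite /box_volume big_ord_recl /= mxE subrr mul0r.
Qed.

Let le_lebesgue_outer :
  {homo lebesgue_outer : A B / A `<=` B >-> A <= B}.
Proof.
move=> A B AB; apply: ereal_inf_le_tmp => _ [ab [le_ab Bab] <-].
by exists ab => //; split=> //; exact: subset_trans AB Bab.
Qed.

Let lebesgue_outer_sigma_subadditive : sigma_subadditive lebesgue_outer.
Proof.
move=> A; have [[i ioo]|] := pselect (exists i, lebesgue_outer (A i) = +oo).
  rewrite (eseries_pinfty _ _ ioo) ?leey// => n _.
  by rewrite -ltNye (lt_le_trans _ (lebesgue_outer_ge0 _)).
rewrite -forallNE => Aoo.
suff add2e (e : {posnum R}) : lebesgue_outer (\bigcup_n A n) <=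
    \sum_(i <oo) lebesgue_outer (A i) + e%:num%:E.
  by apply/lee_addgt0Pr => _/posnumP[].
rewrite (le_trans _ (epsilon_trick _ _ _))//.
pose P n (ab : nat -> V * V) := box_cover (A n) ab /\
  \sum_(k <oo) box_volume (ab k) <=
    lebesgue_outer (A n) + (e%:num / (2 ^ n.+1)%:R)%:E.
have [G PG] : {G : nat -> nat -> V * V & forall n, P n (G n)}.
  apply: (@choice _ _ P) => n; rewrite /P /lebesgue_outer.
  set S := (X in ereal_inf X); move infS : (ereal_inf S) => iS.
  case: iS infS => [r Sr|Soo|Soo].
  - have en1 : (0 < e%:num / (2 ^ n.+1)%:R)%R by [].
    have /(lb_ereal_inf_adherent en1) : ereal_inf S \is a fin_num by rewrite Sr.
    move=> [x [B cB <-] xS].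
    by exists B; split => //; rewrite -Sr; exact/ltW.
  - by have := Aoo n; rewrite /lebesgue_outer Soo.
  - suff : lbound S 0 by move/le_ereal_inf_tmp; rewrite Soo.
    move=> /= _ [B cB <-]; apply: nneseries_ge0 => k _ _.
    exact: box_volume_ge0 cB.
have G_ge0 x : 0 <= (box_volume \o uncurry G) x.
  by case: x => n k /=; exact: box_volume_ge0 (PG n).1.
apply: (@le_trans _ _ (\esum_(i in setT) (box_volume \o uncurry G) i)).
  apply: ereal_inf_lbound => /=.
  have /card_esym/ppcard_eqP[f] := card_nat2.
  exists (uncurry G \o f).
    split => [k i|] /=; first by case: (f k) => n j; exact: (PG n).1.1.
    apply: (@subset_trans _ (\bigcup_n \bigcup_k box (G n k))) => [t [i _]|].
      by move=> /(PG i).1.2 -[j _ ?]; exists i => //; exists j.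
    move=> t [i _ [j _ Bijt]]; exists (f^-1%FUN (i, j)) => //=.
    by rewrite invK ?inE.
  rewrite -(esum_pred_image (box_volume \o uncurry G) _ xpredT) ?[fun=> _]set_true//.
  by rewrite image_eq.
rewrite (_ : esum _ _ = \sum_(i <oo) \sum_(j <oo ) box_volume (G i j)); last first.
  pose J : nat -> set (nat * nat) := fun i => [set (i, j) | j in setT].
  rewrite (_ : setT = \bigcup_k J k); last first.
    by rewrite predeqE => -[a b]; split => // _; exists a => //; exists b.
  rewrite esum_bigcupT //=; last first.
    apply/trivIsetP => i j _ _ ij.
    rewrite predeqE => -[n m] /=; split => //= -[] [_] _ [<-{n} _].
    by move=> [m' _] [] /esym/eqP; rewrite (negbTE ij).
  rewrite -(image_id [set: nat]) -fun_true esum_pred_image//; last first.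
    by move=> n _; apply: esum_ge0 => j _; exact: G_ge0.
  apply: eq_eseriesr => /= j _.
  rewrite -(esum_pred_image (box_volume \o uncurry G) (pair j) predT)//=; last 2 first.
  - by move=> n _; exact: (G_ge0 (j, n)).
  - by move=> ? ? _ _; exact: (@can_inj _ _ _ snd).
  by congr esum; rewrite predeqE => -[a b]; split; move=> [i _ <-]; exists i.
apply: lee_lim.
- apply: is_cvg_nneseries => n *.
  by apply: nneseries_ge0 => m *; exact: (G_ge0 (n, m)).
- by apply: is_cvg_nneseries => n *; apply: adde_ge0.
- by near=> n; apply: lee_sum => i _; exact: (PG i).2.
Unshelve. all: by end_near. Qed.

HB.instance Definition _ := isOuterMeasure.Build R V lebesgue_outer
  lebesgue_outer0 lebesgue_outer_ge0 le_lebesgue_outer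
  lebesgue_outer_sigma_subadditive.

End lebesgue_rV.

Definition caratheodory_measure (R : realType) (T : pointedType)
    (mu : {outer_measure set T -> \bar R}) :
  {measure set (caratheodory_type mu) -> \bar R} := mu.

Definition lebesgue_rV (R : realType) (d : nat) :
    {measure set (caratheodory_type (@lebesgue_outer R d)) -> \bar R} :=
  caratheodory_measure (@lebesgue_outer R d).

Definition is_domain (R : realType) (d : nat) (Omega : set 'rV[R]_d) :=
  [/\ open Omega, connected Omega & Omega !=set0].

(* For q < +oo, functions that are not Lebesgue measurable, hence not in
   L_q(Omega), have norm +oo.  Measurability and integral are those of the
   extension by 0, Omega being open in the sequel.  For q = +oo the norm is the
   supremum over Omega, not the essential supremum. *)
Definition Lq_norm (R : realType) (d : nat) (Omega : set 'rV[R]_d.+1)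
    (q : \bar R) (f : Omega -> R) : \bar R :=
  if q == +oo%E then ereal_sup [set `|f y|%:E | y in [set: Omega]]
  else let f0 : caratheodory_type (@lebesgue_outer R d) -> R := 'valL_0 f in
       if `[< measurable_fun setT f0 >]
       then ('N[lebesgue_rV R d]_q[EFin \o f0])%E else +oo%E.

(* In the next two definitions p ranges over [1, +oo]; the default branch is
   meant for p = +oo. *)
Definition lp_norm (R : realType) (N : nat) (p : \bar R) (y : 'I_N -> R) : R :=
  match p with
  | r%:E => (\sum_(j < N) `|y j| `^ r) `^ r^-1
  | _ => \big[Num.max/0]_(j < N) `|y j|
  end.

Definition lp_const (R : realType) (N : nat) (p : \bar R) : R :=
  match p with
  | r%:E => if r <= 2 then N%:R `^ (r^-1 - 2^-1) else 1
  | _ => 1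
  end.

(* A reproducing kernel Hilbert space of functions T -> R.  Its elements are
   identified with functions through the injective linear map [rkhs_eval]; the
   reproducing kernel is K(x, y) = rkhs_eval (rkhs_kernel y) x. *)
Record rkhs (R : realType) (T : Type) := RKHS {
  rkhs_space :> completeNormedModType R ;
  rkhs_dot : rkhs_space -> rkhs_space -> R ;
  rkhs_dotC : forall f g, rkhs_dot f g = rkhs_dot g f ;
  rkhs_dotPl : forall a f g h,
    rkhs_dot (a *: f + g) h = a * rkhs_dot f h + rkhs_dot g h ;
  rkhs_dot_norm : forall f, rkhs_dot f f = `|f| ^+ 2 ;
  rkhs_eval : {linear rkhs_space -> (T -> R^o)} ;
  rkhs_eval_inj : injective rkhs_eval ;
  rkhs_kernel : T -> rkhs_space ;
  rkhs_reproducing : forall f y, rkhs_eval f y = rkhs_dot f (rkhs_kernel y)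
}.
Arguments rkhs_dot {R T r}.
Arguments rkhs_eval {R T r}.
Arguments rkhs_kernel {R T r}.

Definition closed_subspace (R : realType) (T : Type) (H : rkhs R T)
    (H1 : set H) :=
  [/\ H1 0, (forall (a : R) u v, H1 u -> H1 v -> H1 (a *: u + v)) & closed H1].

Definition orthocompl (R : realType) (T : Type) (H : rkhs R T)
    (H1 : set H) : set H :=
  [set g | forall s, H1 s -> rkhs_dot g s = 0].

(* The value x0 is irrelevant when the minimum is attained. *)
Definition argmin (R : realType) (T : choiceType) (x0 : T) (A : set T)
    (J : T -> R) : T :=
  xget x0 [set s | A s /\ forall t, A t -> J s <= J t].

Definition regularized_approx (R : realType) (T : Type) (H : rkhs R T)
    (H1 : set H) (N : nat) (x : 'I_N -> T) (lambda : R) (f : H) : H :=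
  argmin 0 H1 (fun s : H =>
    (\sum_(j < N) `|rkhs_eval f (x j) - rkhs_eval s (x j)| ^+ 2)
    + lambda * `|s| ^+ 2).

(* Main.v *)
Require Import Defs.
From mathcomp Require Import all_boot all_order all_algebra.
From mathcomp Require Import all_classical all_reals all_analysis.
From mathcomp Require Import ring lra.

Set Implicit Arguments.
Unset Strict Implicit.
Unset Printing Implicit Defensive.

Import Order.TTheory GRing.Theory Num.Theory.
Import numFieldNormedType.Exports.

Local Open Scope classical_set_scope.
Local Open Scope ring_scope.

(** Write [s] for the regularized approximation, [B] for the l_2-norm of [f2] on
    the points and [L] for the square root of [lambda].  Since [s] minimizes
    the regularized loss over [H1] and [f1] is a competitor,
[[
      sum_j |(f - s)(x_j)|^2 + L^2 |s|^2 <= B^2 + L^2 |f1|^2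
                                         <= B^2 + L^2 |f|^2,
]]
    the last step by orthogonality.  This controls both norms of [f1 - s], an
    element of [H1], that occur in the sampling inequality: [L |f1 - s|] and
    the l_2-norm of [f1 - s] on the points are at most [2 (B + L |f|)]
    ([regularized_approx_bounds]).  As [L = F1 N / F2 N], multiplication by
    [F2 N] turns this bound into [2 (F1 N |f| + F2 N B)], and [lp_norm_le_l2]
    passes from l_2 to l_p at the cost of the factor [c_p].  The sampling
    inequality applied to [f1 - s] and the triangle inequality
    ([Lq_norm_triangle]) for [f - s = f2 + (f1 - s)] give the first estimate.
    For the second one, [B] is at most [sqrt N] times the supremum of [|f2|]
    ([l2_le_sup]), and the remaining supremum of [|f2|] is absorbed into the
    same term, the constant being allowed to depend on [N].

    All this presupposes that the minimum is attained.  The loss is a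
    nonnegative continuous quadratic function whose [lambda |s|^2] term makes
    it strongly convex, so minimizing sequences in [H1] are Cauchy and converge
    in the closed subspace [H1] ([strongly_midconvex_min],
    [regularized_approxP]). *)

(** * Comparison of the discrete l_p and l_2 norms *)

(** Weighted arithmetic-geometric mean inequality: Young's inequality for the
    conjugate exponents [a^-1] and [(1 - a)^-1], which degenerates at [a = 1]. *)
Lemma powR_wamgm (R : realType) (u v a : R) : 0 <= u -> 0 <= v -> 0 < a <= 1 ->
  u `^ a * v `^ (1 - a) <= a * u + (1 - a) * v.
Proof.
move=> u0 v0 /andP[a0]; rewrite le_eqVlt => /predU1P[->|a1].
  by rewrite subrr powRr0 powRr1// mulr1 mul1r mul0r addr0.
have a'0 : 0 < 1 - a by rewrite subr_gt0.
have := @conjugate_powR R (u `^ a) (v `^ (1 - a)) a^-1 (1 - a)^-1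
  (powR_ge0 _ _) (powR_ge0 _ _).
rewrite !invr_gt0 !invrK -!powRrM !divff ?gt_eqF// !powRr1//.
by rewrite [u * a]mulrC [v * _]mulrC; apply=> //; rewrite addrC subrK.
Qed.

Lemma lp_norm2E (R : realType) N (y : 'I_N -> R) :
  lp_norm 2%:E y = Num.sqrt (\sum_(j < N) `|y j| ^+ 2).
Proof.
rewrite /lp_norm -powR12_sqrt; last first.
  by apply: sumr_ge0 => j _; rewrite exprn_ge0.
by under eq_bigr do rewrite (powR_mulrn 2)//.
Qed.

Lemma sqr_le_l2 (R : realType) N (y : 'I_N -> R) j :
  `|y j| ^+ 2 <= \sum_(i < N) `|y i| ^+ 2.
Proof.
by rewrite (bigD1 j)//= lerDl; apply: sumr_ge0 => i _; rewrite exprn_ge0.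
Qed.

(** The power mean inequality between the exponents [r] and 2.  The function
    [t `^ (r / 2)] is concave, and the weighted mean inequality bounds it by
    its tangent at the mean [M] of the squares; the first order terms cancel
    when the bounds are summed. *)
Lemma sum_powR_le (R : realType) N (y : 'I_N -> R) (r : R) : 1 <= r <= 2 ->
  \sum_(j < N) `|y j| `^ r <=
    N%:R `^ (1 - r / 2) * (\sum_(j < N) `|y j| ^+ 2) `^ (r / 2).
Proof.
move=> /andP[r1 r2]; set Q := \sum_(j < N) `|y j| ^+ 2.
have r0 : 0 < r by lra.
have Q0 : 0 <= Q by apply: sumr_ge0 => j _; rewrite exprn_ge0.
have yE j : `|y j| `^ r = (`|y j| ^+ 2) `^ (r / 2).
  by rewrite -(powR_mulrn 2)// -powRrM; congr (_ `^ _); field.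
have [Q_eq0|Q_neq0] := eqVneq Q 0.
  rewrite big1 ?mulr_ge0 ?powR_ge0// => j _; rewrite yE.
  have /eqP -> : `|y j| ^+ 2 == 0.
    by rewrite eq_le exprn_ge0// andbT -Q_eq0 sqr_le_l2.
  by rewrite powR0// gt_eqF// divr_gt0.
have Qgt0 : 0 < Q by rewrite lt_def Q_neq0.
have N0 : (0 < N%:R :> R).
  rewrite ltr0n lt0n; apply: contra_neq Q_neq0 => N_eq0.
  by rewrite /Q big1// => j; have := ltn_ord j; rewrite {2}N_eq0.
pose M := Q / N%:R; have M0 : 0 < M by rewrite divr_gt0.
have QE : Q = N%:R * M by rewrite mulrC divfK ?gt_eqF.
suff le_sum : (\sum_(j < N) `|y j| `^ r) * M `^ (1 - r / 2) <= Q.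
  rewrite -(ler_pM2r (powR_gt0 (1 - r / 2) M0)); apply: le_trans le_sum _.
  rewrite mulrAC -powRM ?(ltW N0) ?(ltW M0)// -QE.
  rewrite -powRD; last by rewrite Q_neq0 implybT.
  by rewrite subrK powRr1 ?Q0.
rewrite mulr_suml.
apply: (@le_trans _ _ (\sum_(j < N) (r / 2 * `|y j| ^+ 2 + (1 - r / 2) * M))).
  apply: ler_sum => j _; rewrite yE; apply: powR_wamgm => //; first exact: ltW.
  by apply/andP; split; lra.
rewrite big_split/= -mulr_sumr sumr_const card_ord -[_ *+ N]mulr_natl -/Q QE.
lra.
Qed.

(** Below the exponent 2 this is the power mean inequality.  Above it, every
    entry is at most the l_2-norm [S], hence [t `^ r <= t ^+ 2 * S `^ (r - 2)]
    for each entry [t]. *)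
Lemma lp_norm_le_l2 (R : realType) N (p : \bar R) (y : 'I_N -> R) :
  (1 <= p)%E ->
  lp_norm p y <= lp_const N p * Num.sqrt (\sum_(j < N) `|y j| ^+ 2).
Proof.
move=> p1; set Q := \sum_(j < N) `|y j| ^+ 2.
have Q0 : 0 <= Q by apply: sumr_ge0 => j _; rewrite exprn_ge0.
have y_le j : `|y j| <= Num.sqrt Q.
  by rewrite -(ler_pXn2r (ltn0Sn 1)) ?nnegrE ?sqrtr_ge0// sqr_sqrtr ?sqr_le_l2.
case: p p1 => [r| |]//=; rewrite ?lee_fin => r1; last first.
  by rewrite mul1r; apply: bigmax_le => [|j _]; rewrite ?sqrtr_ge0 ?y_le.
have r0 : 0 < r by apply: lt_le_trans r1.
have rV0 : 0 <= r^-1 by rewrite invr_ge0 ltW.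
have sum0 : 0 <= \sum_(j < N) `|y j| `^ r.
  by apply: sumr_ge0 => j _; exact: powR_ge0.
have [r2|r2] := leP r 2.
  have /(ge0_ler_powR rV0) : \sum_(j < N) `|y j| `^ r <=
      N%:R `^ (1 - r / 2) * Q `^ (r / 2) by rewrite sum_powR_le// r1.
  rewrite !nnegrE sum0 mulr_ge0 ?powR_ge0// => /(_ isT isT) le_sum.
  apply: le_trans le_sum _; rewrite powRM ?powR_ge0// -!powRrM -powR12_sqrt//.
  rewrite (_ : (1 - r / 2) / r = r^-1 - 2^-1); last by field; rewrite gt_eqF.
  by rewrite (_ : r / 2 / r = 2^-1)//; field; rewrite gt_eqF.
rewrite mul1r; set S := Num.sqrt Q; have S0 : 0 <= S := sqrtr_ge0 _.
have SE : S = (S `^ r) `^ r^-1 by rewrite -powRrM divff ?gt_eqF// powRr1.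
rewrite {1}SE; apply: ge0_ler_powR; rewrite ?nnegrE ?powR_ge0//.
have r20 : 0 <= r - 2 by lra.
have splitr t : 0 <= t -> t `^ r = t ^+ 2 * t `^ (r - 2).
  move=> t0; rewrite -(powR_mulrn 2)// -powRD; last first.
    by apply/implyP; rewrite addrC subrK (gt_eqF r0).
  by rewrite addrC subrK.
rewrite (splitr S)// sqr_sqrtr// mulr_suml; apply: ler_sum => j _.
by rewrite splitr// ler_wpM2l ?exprn_ge0// ge0_ler_powR ?nnegrE ?y_le.
Qed.

(** * Existence of the minimizer *)

(** If [u] and [v] are nearly optimal, their midpoint cannot do better than the
    infimum, so strong convexity forces [u] and [v] to be close: a minimizing
    sequence is Cauchy. *)
Lemma strongly_midconvex_min (R : realType) (V : completeNormedModType R)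
    (A : set V) (J : V -> R) (c : R) :
  closed A -> A !=set0 ->
  (forall u v, A u -> A v -> A (2^-1 *: (u + v))) ->
  continuous J -> (forall u, 0 <= J u) -> 0 < c ->
  (forall u v, A u -> A v ->
    J (2^-1 *: (u + v)) + c * `|u - v| ^+ 2 <= (J u + J v) / 2) ->
  exists2 s, A s & forall t, A t -> J s <= J t.
Proof.
move=> Acl A0 Amid Jcont J0 c0 Jmid; pose m := inf (J @` A).
have infJ : has_inf (J @` A).
  by split; [exact: image_nonempty | exists 0 => _ [u _ <-]].
have leJ t : A t -> m <= J t.
  by move=> At; apply: ge_inf; [case: infJ | exists t].
have [u uP] : {u : nat -> V & forall n, A (u n) /\ J (u n) < m + n.+1%:R^-1}.
  apply: (@choice _ _ (fun n v => A v /\ J v < m + n.+1%:R^-1)) => n.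
  by have [//|_ [v Av <-]] := @inf_adherent _ _ (n.+1%:R^-1) _ infJ; exists v.
have u_dist k n : (k <= n)%N -> c * `|u k - u n| ^+ 2 < k.+1%:R^-1.
  move=> kn; have [[Auk Juk] [Aun Jun]] := (uP k, uP n).
  have := Jmid _ _ Auk Aun; have := leJ _ (Amid _ _ Auk Aun).
  have : n.+1%:R^-1 <= k.+1%:R^-1 :> R by rewrite lef_pV2 ?posrE// ler_nat.
  move: Juk Jun; move: (J _) (c * _) (J (u k)) (J (u n)).
  by move: (k.+1%:R^-1) (n.+1%:R^-1) (m) => *; lra.
have /cauchy_cvgP ucvg : cauchy (u @ \oo).
  apply: cauchy_exP => e e0.
  have ce0 : 0 < c * e ^+ 2 by rewrite mulr_gt0 ?exprn_gt0.
  have [k _ /(_ k (leqnn k)) /= kP] := near_infty_natSinv_lt (PosNum ce0).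
  exists (u k), k => // n /= kn; rewrite -ball_normE /=.
  rewrite -(ltr_pXn2r (ltn0Sn 1)) ?nnegrE ?(ltW e0)//.
  by rewrite -(ltr_pM2l c0) (lt_trans (u_dist _ _ kn)).
have As : A (lim (u @ \oo)).
  by apply: (closed_cvg _ Acl _ _ ucvg); apply: nearW => n; case: (uP n).
exists (lim (u @ \oo)) => // t At; apply: le_trans (leJ t At).
have Jlim : J (u n) @[n --> \oo] --> J (lim (u @ \oo)).
  exact: continuous_cvg (Jcont _) ucvg.
apply: (ler_cvg_to Jlim (g := fun n => m + harmonic n)).
  rewrite -[X in _ --> X]addr0.
  by apply: cvgD; [exact: cvg_cst | exact: cvg_harmonic].
by apply: nearW => n; apply: ltW; case: (uP n).
Qed.

Lemma sqr_midpoint_le (R : realFieldType) (w a b : R) :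
  (w - (a + b) / 2) ^+ 2 <= ((w - a) ^+ 2 + (w - b) ^+ 2) / 2.
Proof.
rewrite -subr_ge0.
by rewrite (_ : _ - _ = ((a - b) / 2) ^+ 2) ?sqr_ge0//; field.
Qed.

Lemma rkhs_dotDl (R : realType) T (H : rkhs R T) (f g h : H) :
  rkhs_dot (f + g) h = rkhs_dot f h + rkhs_dot g h.
Proof. by rewrite -[f in LHS]scale1r rkhs_dotPl mul1r. Qed.

Lemma rkhs_dotNl (R : realType) T (H : rkhs R T) (f h : H) :
  rkhs_dot (- f) h = - rkhs_dot f h.
Proof.
have dot0 : rkhs_dot 0 h = 0.
  by apply: (@addrI _ (rkhs_dot 0 h)); rewrite -rkhs_dotDl !addr0.
by apply/eqP; rewrite -addr_eq0 -rkhs_dotDl addNr dot0.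
Qed.

Lemma rkhs_normD_sqr (R : realType) T (H : rkhs R T) (f g : H) :
  `|f + g| ^+ 2 = `|f| ^+ 2 + 2 * rkhs_dot f g + `|g| ^+ 2.
Proof.
rewrite -!rkhs_dot_norm rkhs_dotDl [rkhs_dot f (f + g)]rkhs_dotC.
rewrite [rkhs_dot g (f + g)]rkhs_dotC !rkhs_dotDl [rkhs_dot g f]rkhs_dotC.
by ring.
Qed.

Lemma rkhs_parallelogram (R : realType) T (H : rkhs R T) (f g : H) :
  `|f + g| ^+ 2 + `|f - g| ^+ 2 = 2 * `|f| ^+ 2 + 2 * `|g| ^+ 2.
Proof.
rewrite !rkhs_normD_sqr normrN [rkhs_dot f (- g)]rkhs_dotC rkhs_dotNl.
by rewrite [rkhs_dot g f]rkhs_dotC; ring.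
Qed.

(** The reproducing property writes the evaluation as a scalar product, and
    polarization expresses this product through norms, which are continuous. *)
Lemma rkhs_eval_continuous (R : realType) T (H : rkhs R T) (y : T) :
  continuous (fun f : H => rkhs_eval f y : R).
Proof.
move=> f; pose k : H := rkhs_kernel y.
rewrite (_ : (fun g : H => rkhs_eval g y : R) =
    (fun g : H => 2^-1 * (`|g + k| * `|g + k| - `|g| * `|g| - `|k| ^+ 2)));
  last first.
  apply/funext => g; rewrite rkhs_reproducing -!expr2 rkhs_normD_sqr -/k.
  by field.
have cvg_nm (h : H) : `|g + h| @[g --> f] --> (`|f + h| : R).
  by apply: cvg_norm; apply: cvgD; [exact: cvg_id | exact: cvg_cst].
have cvg_n : `|g| @[g --> f] --> (`|f| : R) by exact: cvg_norm.
apply: cvgM; first exact: cvg_cst.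
apply: cvgB; last exact: cvg_cst.
by apply: cvgB; apply: cvgM.
Qed.

(** The function of [s] that [regularized_approx] minimizes, named so that its
    convexity and continuity can be stated. *)
Definition regularized_loss (R : realType) T (H : rkhs R T) N (x : 'I_N -> T)
    (lambda : R) (f s : H) : R :=
  (\sum_(j < N) `|rkhs_eval f (x j) - rkhs_eval s (x j)| ^+ 2)
    + lambda * `|s| ^+ 2.

(** The data term is convex, and the parallelogram identity makes the
    penalty term gain exactly [lambda / 4 * `|u - v| ^+ 2] at the midpoint. *)
Lemma regularized_loss_midpoint (R : realType) T (H : rkhs R T) N
    (x : 'I_N -> T) (lambda : R) (f u v : H) :
  regularized_loss x lambda f (2^-1 *: (u + v)) + lambda / 4 * `|u - v| ^+ 2 <=
    (regularized_loss x lambda f u + regularized_loss x lambda f v) / 2.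
Proof.
rewrite /regularized_loss normrZ exprMn ger0_norm ?invr_ge0//.
set S := \sum_(j < N) _; set Su := \sum_(j < N) _; set Sv := \sum_(j < N) _.
have S_le : S <= (Su + Sv) / 2.
  rewrite /S /Su /Sv -big_split/= mulr_suml; apply: ler_sum => j _.
  rewrite !real_normK ?num_real//.
  have -> : rkhs_eval (2^-1 *: (u + v)) (x j) =
      (rkhs_eval u (x j) + rkhs_eval v (x j)) / 2 :> R.
    by rewrite linearZ linearD/= mulrC.
  exact: sqr_midpoint_le.
have := rkhs_parallelogram u v.
move: (`|u + v| ^+ 2) (`|u - v| ^+ 2) (`|u| ^+ 2) (`|v| ^+ 2) => a b c e abce.
have : lambda / 4 * (a + b) = lambda / 2 * (c + e) by rewrite abce; field.
by move: S_le; lra.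
Qed.

(** [regularized_approx] takes a default value when no minimizer exists; the
    existence theorem shows that it is a genuine minimizer. *)
Lemma regularized_approxP (R : realType) T (H : rkhs R T) (H1 : set H) N
    (x : 'I_N -> T) (lambda : R) (f : H) :
  closed_subspace H1 -> 0 < lambda ->
  H1 (regularized_approx H1 x lambda f) /\
  forall t, H1 t ->
    regularized_loss x lambda f (regularized_approx H1 x lambda f) <=
    regularized_loss x lambda f t.
Proof.
move=> [H10 H1lin H1cl] l0.
suff [s H1s smin] : exists2 s, H1 s & forall t, H1 t ->
    regularized_loss x lambda f s <= regularized_loss x lambda f t.
  rewrite /regularized_approx /argmin.
  by case: xgetP => [_ _ []//|/(_ s)] []; split.
apply: (@strongly_midconvex_min _ _ _ _ (lambda / 4)) => //.
- by exists 0.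
- move=> u v H1u H1v.
  have H1uv : H1 (u + v) by rewrite -[u]scale1r; exact: H1lin.
  by rewrite -[_ *: _]addr0; exact: H1lin.
- move=> u; apply: cvgD; last first.
    apply: cvgM; first exact: cvg_cst.
    by apply: cvgM; exact: cvg_norm.
  apply: cvg_big => [|j _]; first exact: add_continuous.
  apply: cvgM; apply: cvg_norm; apply: cvgB;
    by [exact: cvg_cst | exact: rkhs_eval_continuous].
- move=> u; apply: addr_ge0; last by rewrite mulr_ge0 ?(ltW l0) ?exprn_ge0.
  by apply: sumr_ge0 => j _; rewrite exprn_ge0.
- by rewrite divr_gt0.
- by move=> u v _ _; exact: regularized_loss_midpoint.
Qed.

(** * The L_q norm *)

(** The empty domain has to be excluded: the supremum over it is [-oo]. *)
Lemma Lq_norm_ge0 (R : realType) d (Omega : set 'rV[R]_d.+1) (q : \bar R)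
    (f : Omega -> R) : Omega !=set0 -> (0 <= Lq_norm q f)%E.
Proof.
move=> [w Ow]; rewrite /Lq_norm; case: ifP => _; last first.
  by case: ifP => _; rewrite ?Lnorm_ge0 ?leey.
apply: le_ereal_sup_tmp; exists `|f (exist _ w (mem_set Ow))|%:E.
  by exists (exist _ w (mem_set Ow)).
by rewrite lee_fin.
Qed.

(** Pointwise for [q = +oo], Minkowski's inequality otherwise.  When one summand
    is not measurable the right-hand side is [+oo]. *)
Lemma Lq_norm_triangle (R : realType) d (Omega : set 'rV[R]_d.+1) (q : \bar R)
    (f g : Omega -> R) : Omega !=set0 -> (1 <= q)%E ->
  (Lq_norm q (f \+ g)%R <= Lq_norm q f + Lq_norm q g)%E.
Proof.
move=> O0 q1; have := Lq_norm_ge0 q f O0; have := Lq_norm_ge0 q g O0.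
rewrite /Lq_norm; case: ifPn => [_ _ _|qy].
  apply: ge_ereal_sup => _ [w _ <-].
  apply: (@le_trans _ _ (`|f w| + `|g w|)%:E).
    by rewrite lee_fin ler_normD.
  by rewrite EFinD leeD// ereal_sup_ubound//; exists w.
have valL_add : 'valL_0 (f \+ g) = ('valL_0 f \+ 'valL_0 g)%R.
  by apply/funext => w /=; case: ('oinv_set_val w) => //=; rewrite addr0.
case: asboolP => mg; last first.
  move=> _ /(lt_le_trans ltNy0)/gt_eqF/negbT/addey ->; exact: leey.
case: asboolP => mf; last first.
  move=> /(lt_le_trans ltNy0)/gt_eqF/negbT/addye -> _; exact: leey.
move=> _ _; rewrite valL_add asboolT; last first.
  exact: measurable_realfun.measurable_funD.
exact: eminkowski.
Qed.

(** Each of the [N] squares under the root is at most the square of the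
    supremum.  The domain may be empty only if [N = 0], and then both sides
    are 0, although the supremum is [-oo]. *)
Lemma l2_le_sup (R : realType) d (Omega : set 'rV[R]_d.+1) N
    (x : 'I_N -> Omega) (f : Omega -> R) :
  ((lp_norm 2%:E (fun j => f (x j)))%:E <=
    (Num.sqrt N%:R)%:E * Lq_norm +oo f)%E.
Proof.
rewrite /Lq_norm eqxx; set M := ereal_sup _.
have fM j : (`|f (x j)|%:E <= M)%E by apply: ereal_sup_ubound; exists (x j).
rewrite lp_norm2E; case: N x fM => [|N] x fM.
  by rewrite big_ord0 sqrtr0 mul0e.
have : (0 <= M)%E by apply: le_trans (fM ord0); rewrite lee_fin.
case: M fM => [m| |]// fM m0; last first.
  by rewrite gt0_muley ?leey// lte_fin sqrtr_gt0 ltr0n.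
rewrite -EFinM lee_fin -[m]ger0_norm// -sqrtr_sqr -sqrtrM ?ler0n//.
rewrite ler_wsqrtr// mulr_natl -[in leRHS](card_ord N.+1) -sumr_const.
apply: ler_sum => j _; rewrite ler_pXn2r ?nnegrE//.
exact: fM.
Qed.

(** * Stability of the regularized approximation *)

Lemma le_norm_orthD (R : realType) T (H : rkhs R T) (f g : H) :
  rkhs_dot f g = 0 -> `|f| <= `|f + g|.
Proof.
move=> fg0; rewrite -(ler_pXn2r (ltn0Sn 1)) ?nnegrE// rkhs_normD_sqr fg0.
by rewrite mulr0 addr0 lerDl exprn_ge0.
Qed.

Lemma sum_sqrB_le (R : realDomainType) N (y z : 'I_N -> R) :
  \sum_(j < N) `|y j - z j| ^+ 2 <=
    2 * (\sum_(j < N) `|y j| ^+ 2 + \sum_(j < N) `|z j| ^+ 2).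
Proof.
rewrite -big_split/= mulr_sumr; apply: ler_sum => j _.
rewrite !real_normK ?num_real//; have := sqr_ge0 (y j + z j).
by move: (y j) (z j) => a b; nra.
Qed.

(** Comparing the losses of [s] and [f1] bounds [sum_j |(f - s)(x_j)|^2] and
    [lambda |s|^2] by [B^2 + lambda |f1|^2].  On the points, [f1 - s] is the
    difference of [f - s] and [f2]; the crude bound [sum_sqrB_le] on it is
    enough because the target constant 2 leaves room. *)
Lemma regularized_approx_bounds (R : realType) T (H : rkhs R T) (H1 : set H) N
    (x : 'I_N -> T) (lambda : R) (f f1 f2 : H) :
  closed_subspace H1 -> 0 < lambda ->
  H1 f1 -> orthocompl H1 f2 -> f = f1 + f2 ->
  let s := regularized_approx H1 x lambda f in
  let B := Num.sqrt (\sum_(j < N) `|rkhs_eval f2 (x j)| ^+ 2) in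
  Num.sqrt lambda * `|f1 - s| <= 2 * (B + Num.sqrt lambda * `|f|) /\
  Num.sqrt (\sum_(j < N) `|rkhs_eval (f1 - s) (x j)| ^+ 2) <=
    2 * (B + Num.sqrt lambda * `|f|).
Proof.
move=> H1cl l0 H1f1 f2orth fE s B.
have [_ /(_ _ H1f1)] := regularized_approxP x f H1cl l0; rewrite -/s.
have evB (u v : H) y : rkhs_eval u y - rkhs_eval v y = rkhs_eval (u - v) y.
  by rewrite linearB.
rewrite /regularized_loss; under eq_bigr do rewrite evB.
under [X in _ <= X + _]eq_bigr do rewrite evB.
rewrite fE [f1 + f2 - f1]addrC addKr -fE.
have BE : \sum_(j < N) `|rkhs_eval f2 (x j)| ^+ 2 = B ^+ 2.
  by rewrite sqr_sqrtr//; apply: sumr_ge0 => j _; rewrite exprn_ge0.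
have B0 : 0 <= B by rewrite sqrtr_ge0.
rewrite BE; set A := \sum_(j < N) _; set L := Num.sqrt lambda.
have A0 : 0 <= A by apply: sumr_ge0 => j _; rewrite exprn_ge0.
have LE : lambda = L ^+ 2 by rewrite sqr_sqrtr ?(ltW l0).
have L0 : 0 < L by rewrite sqrtr_gt0.
have f1f : L * `|f1| <= L * `|f|.
  by rewrite fE ler_pM2l// le_norm_orthD// rkhs_dotC f2orth.
rewrite LE -!exprMn => minle.
have L_ge0 (h : H) : 0 <= L * `|h| by rewrite mulr_ge0 ?(ltW L0).
have f1f2 : (L * `|f1|) ^+ 2 <= (L * `|f|) ^+ 2 by rewrite ler_pXn2r ?nnegrE.
have Bf0 : 0 <= B * (L * `|f|) by rewrite mulr_ge0.
have Bf_ge0 : 0 <= B + L * `|f| by rewrite addr_ge0.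
split.
  have sle : L * `|s| <= B + L * `|f|.
    by rewrite -(ler_pXn2r (ltn0Sn 1)) ?nnegrE// sqrrD; lra.
  have : L * `|f1 - s| <= L * `|f1| + L * `|s|.
    by rewrite -mulrDr ler_pM2l// ler_normB.
  by move: f1f B0; lra.
have gE j : rkhs_eval (f1 - s) (x j) =
    rkhs_eval (f - s) (x j) - rkhs_eval f2 (x j).
  by rewrite evB fE addrAC addrK.
under eq_bigr do rewrite gE.
rewrite -[leRHS]ger0_norm ?mulr_ge0// -sqrtr_sqr ler_wsqrtr//.
apply: le_trans (sum_sqrB_le _ _) _; rewrite BE -/A exprMn sqrrD.
by have := sqr_ge0 (L * `|s|); have := sqr_ge0 (L * `|f|); lra.
Qed.

Lemma lp_const_ge0 (R : realType) N (p : \bar R) : 0 <= lp_const N p.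
Proof. by case: p => [r| |]//=; case: ifP => // _; exact: powR_ge0. Qed.

(** * The sampling estimate *)

Theorem corollary2p6 (R : realType) (d : nat) (Omega : set 'rV[R]_d.+1)
    (H : rkhs R Omega) (H1 : set H) (p q : \bar R)
    (N : nat) (x : 'I_N -> Omega) (C : R) (F1 F2 : nat -> R) (lambda : R) :
  is_domain Omega ->
  closed_subspace H1 ->
  (1 <= p)%E -> (1 <= q)%E ->
  (0 < N)%N -> injective x ->
  0 < C ->
  (forall n, 0 <= F1 n) -> (forall n, 0 <= F2 n) ->
  0 < F1 N -> 0 < F2 N ->
  (forall g : H, H1 g ->
    (Lq_norm q (rkhs_eval g) <=
      (C * (F1 N * `|g| + F2 N * lp_norm p (fun j => rkhs_eval g (x j))))%:E)%E) ->
  0 < lambda -> Num.sqrt lambda = F1 N / F2 N ->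
  (forall f f1 f2 : H, H1 f1 -> orthocompl H1 f2 -> f = f1 + f2 ->
    (Lq_norm q (rkhs_eval (f - regularized_approx H1 x lambda f)%R) <=
      Lq_norm q (rkhs_eval f2) +
      (2 * C * (1 + lp_const N p) *
        (F1 N * `|f| + F2 N * lp_norm 2%:E (fun j => rkhs_eval f2 (x j))))%:E)%E) /\
  (p = +oo%E -> q = +oo%E ->
    exists Ct : R, 0 < Ct /\
    forall f f1 f2 : H, H1 f1 -> orthocompl H1 f2 -> f = f1 + f2 ->
      (Lq_norm +oo (rkhs_eval (f - regularized_approx H1 x lambda f)%R) <=
        Ct%:E * ((F1 N * `|f|)%:E +
                 (Num.sqrt N%:R * F2 N)%:E * Lq_norm +oo (rkhs_eval f2)))%E).
Proof.
move=> [_ _ O0] H1cl p1 q1 N0 _ C0 _ _ F1gt0 F2gt0 sampling l0 lE.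
set est := (X in X /\ _); have main : est.
  rewrite {}/est => f f1 f2 H1f1 f2orth fE; set s := regularized_approx _ _ _ _.
  have H1g : H1 (f1 - s).
    have [_ H1lin _] := H1cl; have [H1s _] := regularized_approxP x f H1cl l0.
    by rewrite addrC -scaleN1r; exact: H1lin.
  have -> : rkhs_eval (f - s)%R = (rkhs_eval f2 \+ rkhs_eval (f1 - s)%R)%R.
    have <- : rkhs_eval (f2 + (f1 - s))%R =
        (rkhs_eval f2 \+ rkhs_eval (f1 - s)%R)%R by rewrite linearD.
    by rewrite fE addrA [f2 + f1]addrC.
  apply: le_trans (Lq_norm_triangle _ _ O0 q1) _; rewrite leeD2l//.
  apply: le_trans (sampling _ H1g) _; rewrite lee_fin.
  have [] := regularized_approx_bounds x H1cl l0 H1f1 f2orth fE.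
  rewrite lE -/s lp_norm2E; set B := Num.sqrt _ => gle.
  set G := Num.sqrt _ => Gle.
  set E := F1 N * `|f| + F2 N * B.
  (* since L = F1 N / F2 N, multiplying 2 * (B + L * |f|) by F2 N gives 2 * E *)
  have scale t : t <= 2 * (B + F1 N / F2 N * `|f|) -> F2 N * t <= 2 * E.
    rewrite -(ler_pM2l F2gt0) => /le_trans; apply.
    rewrite (_ : F2 N * _ = 2 * E)//.
    by rewrite /E; field; rewrite gt_eqF.
  have gE : F1 N * `|f1 - s| <= 2 * E.
    by move: (scale _ gle); rewrite mulrA [F2 N * _]mulrC divfK ?gt_eqF.
  have lpE : F2 N * lp_norm p (fun j => rkhs_eval (f1 - s) (x j)) <=
      lp_const N p * (2 * E).
    apply: (@le_trans _ _ (lp_const N p * (F2 N * G))).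
      by rewrite mulrCA ler_pM2l// lp_norm_le_l2.
    by rewrite ler_wpM2l ?lp_const_ge0 ?scale.
  have -> : 2 * C * (1 + lp_const N p) * E =
    C * (2 * E + lp_const N p * (2 * E)) by ring.
  by rewrite ler_pM2l// lerD.
split=> // py qy; have D0 : 0 < Num.sqrt N%:R * F2 N.
  by rewrite mulr_gt0// sqrtr_gt0 ltr0n.
set D := Num.sqrt _ * _ in D0 *.
(* 4 * C is the constant 2 * C * (1 + c_p) with c_p = 1; the summand D^-1
   absorbs the free supremum of |f2|, which is D^-1 * (D * sup |f2|). *)
exists (4 * C + D^-1); split; first by rewrite addr_gt0 ?mulr_gt0 ?invr_gt0.
move=> f f1 f2 H1f1 f2orth fE.
have := main f f1 f2 H1f1 f2orth fE; rewrite py qy [lp_const _ _]/=.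
move=> /le_trans; apply.
have := l2_le_sup x (rkhs_eval f2).
have := Lq_norm_ge0 +oo (rkhs_eval f2) O0.
set B := lp_norm _ _; have K0 : 0 < 4 * C + D^-1.
  by rewrite addr_gt0 ?mulr_gt0 ?invr_gt0.
case: (Lq_norm +oo (rkhs_eval f2)) => [m| |]//; last first.
  by move=> _ _; rewrite gt0_muley ?lte_fin// addey// gt0_muley ?lte_fin// leey.
rewrite -!(EFinM, EFinD) !lee_fin => m0 Bm.
have f0 : 0 <= F1 N * `|f| by rewrite mulr_ge0 ?(ltW F1gt0).
have F2B : F2 N * B <= D * m by rewrite /D mulrAC mulrC ler_pM2r.
have CB : C * (F2 N * B) <= C * (D * m) by rewrite ler_pM2l.
have Df0 : 0 <= D^-1 * (F1 N * `|f|) by rewrite mulr_ge0 ?invr_ge0 ?(ltW D0).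
have mE : D^-1 * (D * m) = m by rewrite mulKf ?gt_eqF.
by move: (D^-1) mE Df0 => *; lra.
Qed.
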